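(* For all $2\leq p<\infty$ there exists a closed subspace $E\subseteq L_p[0,1]$ such that $E$ does stable phase retrieval in $L_p[0,1]$ but $E$ fails to do stable phase retrieval in $L_q[0,1]$ for all $1\leq q<p$.
   Context: All $L_p$-spaces are real, and $E\subseteq L_p[0,1]$ is regarded as a subspace of $L_q[0,1]$ via the inclusion $L_p[0,1]\subseteq L_q[0,1]$. A subspace $E\subseteq L_r[0,1]$ does stable phase retrieval in $L_r[0,1]$ if there is a constant $C$ such that $\min_{\lambda\in\{1,-1\}}\|f-\lambda g\|_{L_r}\leq C\big\||f|-|g|\big\|_{L_r}$ for all $f,g\in E$. *)

(* Defs.v *)
From HB Require Import structures.
From mathcomp Require Import all_boot all_order all_algebra.
From mathcomp Require Import all_classical all_reals all_analysis.
From mathcomp Require Import measurable_realfun ess_sup_inf.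

Set Implicit Arguments.
Unset Strict Implicit.
Unset Printing Implicit Defensive.

Import Order.TTheory GRing.Theory Num.Def Num.Theory.
Import numFieldNormedType.Exports.

Local Open Scope classical_set_scope.
Local Open Scope ring_scope.
Local Open Scope quotient_scope.

Lemma ae_eq_Lnorm d (T : measurableType d) (R : realType)
    (mu : {measure set T -> \bar R}) (p : \bar R) (f g : T -> R) :
  measurable_fun [set: T] f -> measurable_fun [set: T] g ->
  f = g %[ae mu] -> ('N[mu]_p[EFin \o f] = 'N[mu]_p[EFin \o g])%E.
Proof.
move=> mf mg fg; rewrite unlock; case: p => [r||].
- have mpow (h : T -> R) : measurable_fun [set: T] h ->
      measurable_fun [set: T] (fun x => (`|(EFin \o h) x| `^ r)%E).
    move=> mh; apply: (@measurableT_comp _ _ _ _ _ _ (fun x => x `^ r)%E).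
      exact: measurable_poweR.
    by apply: measurableT_comp => //; exact/measurable_EFinP.
  congr (_ `^ _)%E; apply: ae_eq_integral => //; [exact: mpow|exact: mpow|].
  by apply: filterS fg => x /= /(_ I) -> _.
- case: ifPn => // _; apply: eq_ess_sup.
  by apply: filterS fg => x /= /(_ I) ->.
- case: ifPn => // _; apply: eq_ess_inf.
  by apply: filterS fg => x /= /(_ I) ->.
Qed.

Lemma filterS4 T (F : set_system T) {FF : Filter F} (P Q S U V : set T) :
  (forall x, P x -> Q x -> S x -> U x -> V x) ->
  F P -> F Q -> F S -> F U -> F V.
Proof.
move=> PV FP FQ FS FU.
by apply: filterS3 (filterI FP FQ) FS FU => x [Px Qx]; exact: PV.
Qed.

Lemma filterS5 T (F : set_system T) {FF : Filter F} (P Q S U V W : set T) :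
  (forall x, P x -> Q x -> S x -> U x -> V x -> W x) ->
  F P -> F Q -> F S -> F U -> F V -> F W.
Proof.
move=> PV FP FQ FS FU FV.
by apply: filterS4 (filterI FP FQ) FS FU FV => x [Px Qx]; exact: PV.
Qed.

Lemma Lfun_intro d (T : measurableType d) (R : realType)
    (mu : {measure set T -> \bar R}) (p : \bar R) (f : T -> R) :
  measurable_fun [set: T] f -> finite_norm mu p f -> f \in Lfun mu p.
Proof. by move=> mf lf; rewrite inE; apply/andP; split; rewrite inE. Qed.

Section Lspace.
Context d (T : measurableType d) (R : realType).
Variables (mu : {measure set T -> \bar R}) (p : \bar R) (p1 : (1 <= p)%E).
Local Notation L := (LspaceType mu p1).

HB.instance Definition _ := gen_eqMixin L.
HB.instance Definition _ := gen_choiceMixin L.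

Definition Lrepr (f : L) : T -> R := f.

Lemma measurable_Lrepr (f : L) : measurable_fun [set: T] (Lrepr f).
Proof. exact: (@measurable_funPT _ _ _ _ (repr (LebesgueSpace.sort f))). Qed.

Lemma Lrepr_Lfun (f : L) : Lrepr f \in Lfun mu p.
Proof.
apply: Lfun_intro; first exact: measurable_Lrepr.
exact: Lebesgue_finite.
Qed.

Lemma Lrepr_inj (f g : L) : Lrepr f = Lrepr g %[ae mu] -> f = g.
Proof.
move=> fg.
have {fg} : LebesgueSpace.sort f = LebesgueSpace.sort g.
  rewrite -[LHS]reprK -[RHS]reprK; apply/eqmodP.
  exact/asboolP.
case: f g => [f [[Pf]]] [g [[Pg]]] /= fg.
by subst g; rewrite (Prop_irrelevance Pf Pg).
Qed.

(* The element of L_p represented by a p-integrable function f. *)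
Section class.
Variables (f : T -> R) (fL : f \in Lfun mu p).

Let mf : measurable_fun [set: T] f.
Proof. by move: fL => /andP[+ _]; rewrite inE. Qed.

Let F : T -> measurableTypeR R := f.

HB.instance Definition _ := @isMeasurableFun.Build _ _ T (measurableTypeR R) F mf.

Let cF : {mfun_ mu, T >-> measurableTypeR R} :=
  \pi_({mfun_ mu, T >-> measurableTypeR R}) (F : {mfun T >-> measurableTypeR R}).

Let cFE : (cF : T -> measurableTypeR R) = F %[ae mu].
Proof.
suff : ae_eq_op mu (repr cF) (F : {mfun T >-> measurableTypeR R}) by move/asboolP.
by rewrite -eqmodE reprK.
Qed.

Let cF_finite : finite_norm mu p (cF : T -> R).
Proof.
rewrite /finite_norm (ae_eq_Lnorm _ _ _ cFE)//; last first.
  exact: (@measurable_funPT _ _ _ _ (repr cF)).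
by move: fL => /andP[_]; rewrite inE.
Qed.

HB.instance Definition _ := isFinLebesgue.Build d T R mu p p1 cF cF_finite.

Definition Lclass : L := cF.

Lemma LclassE : Lrepr Lclass = f %[ae mu].
Proof. exact: cFE. Qed.

End class.

Let subL := @Lfun_submod_closed _ T R mu p p1.

Lemma Lfun0 : (cst 0 : T -> R) \in Lfun mu p.
Proof. exact: (proj1 subL). Qed.

Lemma LfunZD a (f g : T -> R) : f \in Lfun mu p -> g \in Lfun mu p ->
  (fun x => a * f x + g x) \in Lfun mu p.
Proof. exact: (proj2 subL). Qed.

Lemma LfunD (f g : T -> R) : f \in Lfun mu p -> g \in Lfun mu p ->
  (fun x => f x + g x) \in Lfun mu p.
Proof.
move=> fL gL; have := LfunZD 1 fL gL.
by under [X in X \in _]eq_fun do rewrite mul1r.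
Qed.

Lemma LfunZ a (f : T -> R) : f \in Lfun mu p -> (fun x => a * f x) \in Lfun mu p.
Proof.
move=> fL; have := LfunZD a fL Lfun0.
by under [X in X \in _]eq_fun do rewrite addr0.
Qed.

Lemma LfunN (f : T -> R) : f \in Lfun mu p -> (fun x => - f x) \in Lfun mu p.
Proof.
move=> fL; have := LfunZ (-1) fL.
by under [X in X \in _]eq_fun do rewrite mulN1r.
Qed.

Lemma Lfun_abs (f : T -> R) : f \in Lfun mu p -> (fun x => `|f x|) \in Lfun mu p.
Proof.
rewrite inE => /andP[]; rewrite !inE /= => mf lf.
apply: Lfun_intro; first exact: measurableT_comp.
rewrite /finite_norm (_ : _ \o _ = abse \o (EFin \o f))//.
by rewrite Lnorm_abse.
Qed.

Definition Lzero : L := Lclass Lfun0.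
Definition Ladd (f g : L) : L := Lclass (LfunD (Lrepr_Lfun f) (Lrepr_Lfun g)).
Definition Lopp (f : L) : L := Lclass (LfunN (Lrepr_Lfun f)).
Definition Lscale a (f : L) : L := Lclass (LfunZ a (Lrepr_Lfun f)).
Definition Labs (f : L) : L := Lclass (Lfun_abs (Lrepr_Lfun f)).
Definition Lpnorm (f : L) : R := fine ('N[mu]_p[EFin \o Lrepr f])%E.

Let zE := LclassE Lfun0.
Let aE f g := LclassE (LfunD (Lrepr_Lfun f) (Lrepr_Lfun g)).
Let oE f := LclassE (LfunN (Lrepr_Lfun f)).
Let sE a f := LclassE (LfunZ a (Lrepr_Lfun f)).

Let LaddA : associative Ladd.
Proof.
move=> f g h; apply: Lrepr_inj.
move: (aE f (Ladd g h)) (aE g h) (aE (Ladd f g) h) (aE f g).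
apply: filterS4 => x /(_ I) E1 /(_ I) E2 /(_ I) E3 /(_ I) E4 _.
by rewrite E1 E2 E3 E4 addrA.
Qed.

Let LaddC : commutative Ladd.
Proof.
move=> f g; apply: Lrepr_inj; move: (aE f g) (aE g f).
by apply: filterS2 => x /(_ I) E1 /(_ I) E2 _; rewrite E1 E2 addrC.
Qed.

Let Ladd0 : left_id Lzero Ladd.
Proof.
move=> f; apply: Lrepr_inj; move: (aE Lzero f) zE.
by apply: filterS2 => x /(_ I) E1 /(_ I) E2 _; rewrite E1 E2 add0r.
Qed.

Let LaddN : left_inverse Lzero Lopp Ladd.
Proof.
move=> f; apply: Lrepr_inj; move: (aE (Lopp f) f) (oE f) zE.
by apply: filterS3 => x /(_ I) E1 /(_ I) E2 /(_ I) E3 _; rewrite E1 E2 E3 addNr.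
Qed.

HB.instance Definition _ := GRing.isZmodule.Build L LaddA LaddC Ladd0 LaddN.

Let LscaleA a b f : Lscale a (Lscale b f) = Lscale (a * b) f.
Proof.
apply: Lrepr_inj; move: (sE a (Lscale b f)) (sE b f) (sE (a * b) f).
by apply: filterS3 => x /(_ I) E1 /(_ I) E2 /(_ I) E3 _; rewrite E1 E2 E3 mulrA.
Qed.

Let Lscale1 : left_id 1 Lscale.
Proof.
move=> f; apply: Lrepr_inj; move: (sE 1 f).
by apply: filterS => x /(_ I) E1 _; rewrite E1 mul1r.
Qed.

Let LscaleDr : right_distributive Lscale +%R.
Proof.
move=> a f g; apply: Lrepr_inj.
move: (aE (Lscale a f) (Lscale a g)) (aE f g) (sE a f) (sE a g).
move: (sE a (Ladd f g)); apply: filterS5 => x.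
move=> /(_ I) E1 /(_ I) E5 /(_ I) E2 /(_ I) E3 /(_ I) E4 _.
by rewrite E1 E2 E5 E3 E4 mulrDr.
Qed.

Let LscaleDl f : {morph Lscale^~ f : a b / a + b}.
Proof.
move=> a b; apply: Lrepr_inj.
move: (sE (a + b) f) (sE a f) (sE b f) (aE (Lscale a f) (Lscale b f)).
apply: filterS4 => x /(_ I) E1 /(_ I) E2 /(_ I) E3 /(_ I) E4 _.
by rewrite E1 E4 E2 E3 mulrDl.
Qed.

HB.instance Definition _ :=
  GRing.Zmodule_isLmodule.Build R L LscaleA Lscale1 LscaleDr LscaleDl.

Let mL (f : T -> R) : f \in Lfun mu p -> measurable_fun [set: T] f.
Proof. by move=> /andP[+ _]; rewrite inE. Qed.

Let LpnormE (f : L) (g : T -> R) : g \in Lfun mu p -> Lrepr f = g %[ae mu] ->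
  (Lpnorm f)%:E = ('N[mu]_p[EFin \o g])%E.
Proof.
move=> gL fg; rewrite -(ae_eq_Lnorm _ _ _ fg); last 2 first.
- exact: measurable_Lrepr.
- exact: mL.
rewrite /Lpnorm fineK// ge0_fin_numE ?Lnorm_ge0//.
exact: Lebesgue_finite.
Qed.

Let LpnormD (f g : L) : Lpnorm (f + g) <= Lpnorm f + Lpnorm g.
Proof.
rewrite -lee_fin EFinD (LpnormE _ (aE f g)); last exact: LfunD (Lrepr_Lfun _) (Lrepr_Lfun _).
rewrite !(LpnormE (Lrepr_Lfun _) (ae_eq_refl _ _ _)).
by apply: eminkowski => //; exact: measurable_Lrepr.
Qed.

Let LpnormZ a (f : L) : Lpnorm (a *: f) = `|a| * Lpnorm f.
Proof.
apply: EFin_inj; rewrite EFinM (LpnormE _ (sE a f)); last exact: LfunZ (Lrepr_Lfun _).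
rewrite (LpnormE (Lrepr_Lfun _) (ae_eq_refl _ _ _)).
exact: (LnormZ (Lfun_Sub p1 (Lrepr_Lfun f)) a).
Qed.

Let Lpnorm0_eq0 (f : L) : Lpnorm f = 0 -> f = 0.
Proof.
move=> f0; apply: Lrepr_inj.
have := fine_Lnormr_eq0 (f := Lfun_Sub p1 (Lrepr_Lfun f)) f0.
move: zE; apply: filterS2 => x /(_ I) E1 /(_ I) E2 _.
by rewrite E1; exact: E2.
Qed.

HB.instance Definition _ := Lmodule_isNormed.Build R L LpnormD LpnormZ Lpnorm0_eq0.

Lemma Lspace_normE (f : L) : `|f|%:E = ('N[mu]_p[EFin \o Lrepr f])%E.
Proof. exact: (LpnormE (Lrepr_Lfun _) (ae_eq_refl _ _ _)). Qed.

Lemma Lrepr0 : Lrepr (0 : L) = cst 0 %[ae mu].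
Proof. exact: LclassE. Qed.

Lemma LreprD (f g : L) : Lrepr (f + g) = (fun x => Lrepr f x + Lrepr g x) %[ae mu].
Proof. exact: LclassE. Qed.

Lemma LreprN (f : L) : Lrepr (- f) = (fun x => - Lrepr f x) %[ae mu].
Proof. exact: LclassE. Qed.

Lemma LreprZ a (f : L) : Lrepr (a *: f) = (fun x => a * Lrepr f x) %[ae mu].
Proof. exact: LclassE. Qed.

Lemma Lrepr_abs (f : L) : Lrepr (Labs f) = (fun x => `|Lrepr f x|) %[ae mu].
Proof. exact: LclassE. Qed.

End Lspace.

Section inclusion.
Context d (T : measurableType d) (R : realType).
Variable mu : {finite_measure set T -> \bar R}.
Variables (q p : \bar R) (q1 : (1 <= q)%E) (p1 : (1 <= p)%E) (qp : (q <= p)%E).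

Lemma Lrepr_Lfun_le (f : LspaceType mu p1) : Lrepr f \in Lfun mu q.
Proof.
apply: (Lfun_subset q1 p1 _ qp); last exact: Lrepr_Lfun.
exact: fin_num_measure.
Qed.

Definition Lincl (f : LspaceType mu p1) : LspaceType mu q1 :=
  Lclass q1 (Lrepr_Lfun_le f).

Lemma Lrepr_incl (f : LspaceType mu p1) : Lrepr (Lincl f) = Lrepr f %[ae mu].
Proof. exact: LclassE. Qed.

End inclusion.

(* The minimum over the sign lambda in {1, -1} of |f - lambda g|. *)
Definition stable_phase_retrieval d (T : measurableType d) (R : realType)
    (mu : {measure set T -> \bar R}) (p : \bar R) (p1 : (1 <= p)%E)
    (E : set (LspaceType mu p1)) :=
  exists C : R, forall f g, E f -> E g ->
    minr `|f - g| `|f + g| <= C * `|Labs f - Labs g|.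

Section lebesgue01.
Context (R : realType).

Definition itv01 : set (measurableTypeR R) := `[0%R, 1%R].

Lemma measurable_itv01 : measurable itv01.
Proof. exact: measurable_itv. Qed.

Lemma itv01_lty : (@lebesgue_measure R itv01 < +oo)%E.
Proof. by rewrite lebesgue_measure_itv/= lte_fin ltr01 -EFinB ltry. Qed.

(* Functions on [0, 1] are encoded as functions on the whole line modulo
   equality almost everywhere on [0, 1]. They are Borel measurable, which gives
   the same classes as Lebesgue measurable functions. *)
Definition lebesgue01 : set (measurableTypeR R) -> \bar R :=
  mfrestr measurable_itv01 itv01_lty.

HB.instance Definition _ := FiniteMeasure.on lebesgue01.

End lebesgue01.
Arguments lebesgue01 {R}.

Notation Lp01 p1 := (LspaceType lebesgue01 p1).

Lemma ge2_ge1 (R : realType) (p : R) : 2 <= p -> (1 <= p%:E)%E.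
Proof. by move=> p2; rewrite lee_fin (le_trans _ p2)// ler1n. Qed.

Lemma lt_leE (R : realType) (q p : R) : q < p -> (q%:E <= p%:E)%E.
Proof. by move=> qp; rewrite lee_fin ltW. Qed.

(* Main.v *)
Require Import Defs.
From HB Require Import structures.
From mathcomp Require Import all_boot all_order all_algebra.
From mathcomp Require Import all_classical all_reals all_analysis.
From mathcomp Require Import measurable_realfun ring lra.

(** The space is the closed linear span of the functions [f_n = r_n + s_n] for
    [n >= 0], where [r_n] is a Rademacher function living on [1/2, 1) and the
    spike [s_n] is constant on [2^-(n+2), 2^-(n+1)), with norm one in L_p.

    Write [X] for the Rademacher part of [sum a_n f_n]. Since [p >= 2], both the
    L_p norm of [X] (Khintchine, [rad_mean_powR]) and the norm of the spikes,
    [(sum |a_n|^p)^(1/p)], are bounded by a multiple of the l_2 norm of [a].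
    As [||f| - |g|| = min(|f - g|, |f + g|)], stable phase retrieval says that
    two elements of the span cannot be almost disjoint. Rademacher sums alone
    can be: [r_i + r_j] and [r_i - r_j] are disjoint. For [a] and [b] of equal
    l_2 norm, however, the identity
      [E X^2 Y^2 = |a|^2 |b|^2 + 2 <a, b>^2 - 2 sum a_i^2 b_i^2]
    shows that [X] and [Y] overlap in a fixed amount unless some coordinate is
    large in both [a] and [b]; in that case the spike of this coordinate is
    shared, and it contributes a fixed amount to the L_p norm of the minimum.
    This dichotomy is [min_overlap], and [overlap_stable] is its homogeneous form.

    In L_q with [q < p] the spikes become negligible: the norm of [s_n] tends to
    zero. The functions [f_n] and [f_(n+1)] have moduli that agree outside the
    spikes, by [overlap_decay], whereas [f_n - f_(n+1)] and [f_n + f_(n+1)] keep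
    a norm bounded below, by [separation].

    A combination of [f_0, ..., f_(N-1)] is constant on the dyadic intervals of
    length [2^-(N+1)], so all integrals are finite averages, and these obey a
    recursion in [N] that plays the role of independence. Both closedness under
    linear operations and the phase retrieval estimate pass from the span to its
    closure, so only finite combinations have to be studied. *)

Set Implicit Arguments.
Unset Strict Implicit.
Unset Printing Implicit Defensive.

Import Order.TTheory GRing.Theory Num.Theory.
Import numFieldNormedType.Exports.

Local Open Scope classical_set_scope.
Local Open Scope ring_scope.

(** * Step functions on the dyadic grid *)

Section dyadic_step.
Context {R : realType}.
Implicit Types (N k : nat) (G H : nat -> R) (x : R).

Definition dyad N k : set (measurableTypeR R) :=
  `[k%:R / 2 ^+ N, k.+1%:R / 2 ^+ N[.

Definition step N G x : R := \sum_(0 <= k < 2 ^ N) G k * \1_(dyad N k) x.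

Definition avg N G : R := (2 ^+ N)^-1 * \sum_(0 <= k < 2 ^ N) G k.

Lemma dyadP N k x : dyad N k x <-> (k%:R <= x * 2 ^+ N) && (x * 2 ^+ N < k.+1%:R).
Proof.
have N0 : (0 : R) < 2 ^+ N by rewrite exprn_gt0.
by rewrite /dyad /= in_itv /= ler_pdivrMr// ltr_pdivlMr.
Qed.

Lemma dyad_inj N j k x : dyad N j x -> dyad N k x -> j = k.
Proof.
move=> /dyadP/andP[j1 j2] /dyadP/andP[k1 k2]; apply/eqP.
have := le_lt_trans j1 k2; have := le_lt_trans k1 j2.
by rewrite !ltr_nat !ltnS => kj jk; rewrite eqn_leq jk kj.
Qed.

Lemma measurable_dyad N k : measurable (dyad N k).
Proof. exact: measurable_itv. Qed.

Lemma lebesgue01_dyad N k : (k < 2 ^ N)%N ->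
  lebesgue01 (dyad N k) = ((2 ^+ N)^-1)%:E.
Proof.
move=> kN; have N0 : (0 : R) < 2 ^+ N by rewrite exprn_gt0.
rewrite /lebesgue01 /mfrestr /mrestr setIidl; last first.
  move=> x /dyadP/andP[k1 k2]; rewrite /itv01 /= in_itv /=.
  rewrite -(ler_pM2r N0) mul0r (le_trans _ k1)//=.
  rewrite -(ler_pM2r N0) mul1r (le_trans (ltW k2))//.
  by rewrite -natrX ler_nat.
rewrite /dyad lebesgue_measure_itv /= lte_fin ltr_pM2r ?invr_gt0// ltr_nat ltnSn.
by rewrite -EFinB -mulrBl -natrB// subSnn mul1r.
Qed.

Lemma step_in N G k x : (k < 2 ^ N)%N -> dyad N k x -> step N G x = G k.
Proof.
move=> kN kx; rewrite /step (big_rem k) /=; last by rewrite mem_index_iota.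
rewrite indicE mem_set// mulr1 big_seq big1 ?addr0// => j.
rewrite mem_rem_uniq ?iota_uniq// inE => /andP[jk _].
rewrite indicE memNset ?mulr0// => jx; move/eqP: jk; apply.
exact: dyad_inj jx kx.
Qed.

(** Pointwise, a step function is the evaluation of its sequence of values at an
    index that depends on the point only; this reduces every pointwise identity
    between step functions to the same identity between sequences. *)
Lemma stepP N x :
  (exists k, forall G, step N G x = G k) \/ (forall G, step N G x = 0).
Proof.
have [[k kN kx]|nk] := pselect (exists2 k, (k < 2 ^ N)%N & dyad N k x).
  by left; exists k => G; exact: step_in.
right => G; rewrite /step big_nat_cond big1// => k; rewrite andbT => /andP[_ kN].
by rewrite indicE memNset ?mulr0// => kx; apply: nk; exists k.
Qed.

Lemma comp_step (phi : R -> R) N G x : phi 0 = 0 ->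
  phi (step N G x) = step N (phi \o G) x.
Proof. by move=> p0; case: (stepP N x) => [[k]|] E; rewrite !E. Qed.

Lemma comp_step2 (phi : R -> R -> R) N G H x : phi 0 0 = 0 ->
  phi (step N G x) (step N H x) = step N (fun k => phi (G k) (H k)) x.
Proof. by move=> p0; case: (stepP N x) => [[k]|] E; rewrite !E. Qed.

Lemma sum_nat_double (V : zmodType) (F : nat -> V) m n :
  \sum_(m.*2 <= k < n.*2) F k = \sum_(m <= j < n) (F j.*2 + F j.*2.+1).
Proof.
have [mn|nm] := leqP m n; last by rewrite !big_geq ?leq_double// ltnW.
rewrite -(subnKC mn); elim: (n - m)%N => [|d IH]; first by rewrite addn0 !big_geq.
rewrite addnS doubleS; have le : (m.*2 <= (m + d).*2)%N by rewrite leq_double leq_addr.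
rewrite [LHS]big_nat_recr/=; last exact: leqW.
by rewrite [X in X + _]big_nat_recr//= IH [RHS]big_nat_recr/= ?leq_addr// addrA.
Qed.

Lemma expn2S N : (2 ^ N.+1 = (2 ^ N).*2)%N.
Proof. by rewrite expnS mul2n. Qed.

Lemma dyad_split N k x :
  \1_(dyad N k) x = \1_(dyad N.+1 k.*2) x + \1_(dyad N.+1 k.*2.+1) x :> R.
Proof.
have mem_dyad M j : (x \in dyad M j) =
    (j%:R <= x * 2 ^+ M) && (x * 2 ^+ M < j%:R + 1).
  by rewrite natr1; apply/idP/idP; rewrite inE => /dyadP.
rewrite !indicE !mem_dyad exprS mulrCA [2 * _]mulrC.
rewrite -[k.*2.+1%:R]natr1 -muln2 natrM; set z := x * 2 ^+ N.
case: (lerP (k%:R * 2) (z * 2)) => h1; case: (lerP (k%:R * 2 + 1) (z * 2)) => h2;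
case: (ltrP (z * 2) (k%:R * 2 + 1)) => h3;
case: (ltrP (z * 2) (k%:R * 2 + 1 + 1)) => h4;
case: (lerP k%:R z) => h5; case: (ltrP z (k%:R + 1)) => h6 /=;
rewrite ?addr0 ?add0r//; exfalso; lra.
Qed.

(** Halving the index at level [N + 1] recovers the index at level [N], so that
    combinations of functions of different levels can be read on one grid. *)
Lemma step_refine N G x : step N.+1 (fun k => G k./2) x = step N G x.
Proof.
rewrite /step expn2S -[X in index_iota X]double0 sum_nat_double.
apply: eq_bigr => k _; rewrite doubleK (half_bit_double k true) -mulrDr.
by rewrite -dyad_split.
Qed.

Lemma measurable_step N G : measurable_fun [set: measurableTypeR R] (step N G).
Proof.
apply: measurable_sum => k; apply: measurable_funM => //.
apply: measurable_indic; exact: measurable_dyad.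
Qed.

Lemma integral_step N G : (forall k, 0 <= G k) ->
  (\int[lebesgue01]_x (step N G x)%:E = (avg N G)%:E)%E.
Proof.
move=> G0; rewrite /step.
under eq_integral do rewrite -sumEFin.
rewrite ge0_integral_sum//=; last 2 first.
- move=> k; apply/measurable_EFinP; apply: measurable_funM => //.
  apply: measurable_indic; exact: measurable_dyad.
- by move=> k x _; rewrite lee_fin mulr_ge0// indicE.
rewrite /avg mulr_sumr -sumEFin big_nat_cond [RHS]big_nat_cond.
apply: eq_bigr => k; rewrite andbT => /andP[_ kN].
rewrite (@integralZl_indic _ _ _ _ _ measurableT (fun=> dyad N k))//; last 2 first.
- by rewrite ltNge G0.
- exact: measurable_dyad.
rewrite integral_indic//; last exact: measurable_dyad.
rewrite setIT [X in _ = X%:E]mulrC EFinM; congr (_ * _)%E; exact: lebesgue01_dyad.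
Qed.

Lemma Lnorm_step q N G : 0 < q ->
  ('N[lebesgue01]_(q%:E)[EFin \o step N G] =
   ((avg N (fun k => `|G k| `^ q)) `^ q^-1)%:E)%E.
Proof.
move=> q0; rewrite unlock.
under eq_integral do rewrite /= (@comp_step (fun y => `|y| `^ q)) ?normr0 ?powR0 ?gt_eqF//.
by rewrite integral_step ?poweR_EFin// => k; exact: powR_ge0.
Qed.

End dyadic_step.

(** * Rademacher sums with tall spikes *)

Section spiky_rademacher.
Context {R : realType} (h : nat -> R).
Implicit Types (N n k : nat) (a b : nat -> R) (P Q : nat -> R).

(** The values of [f_n] on the dyadic grid of level [n + 2]: the upper half of
    the indices is [1/2, 1), and index one is the interval of the spike, whose
    height is [h n]. *)
Definition spiky n k : R :=
  if (2 ^ n.+1 <= k)%N then (-1) ^+ k else if k == 1%N then h n else 0.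

(** The values of [sum_(n < N) a n * f_n] on the grid of level [N + 1]; each new
    term refines the grid once, hence the halved index. *)
Fixpoint spiky_sum a N k : R :=
  if N is N'.+1 then spiky_sum a N' k./2 + a N' * spiky N' k else 0.

Lemma spiky_sum_lin c a b N k :
  spiky_sum (fun n => c * a n + b n) N k = c * spiky_sum a N k + spiky_sum b N k.
Proof. by elim: N k => [|N IH] k /=; rewrite ?IH; ring. Qed.

Lemma spiky_sumZ c a N k :
  spiky_sum (fun n => c * a n) N k = c * spiky_sum a N k.
Proof. by elim: N k => [|N IH] k /=; rewrite ?IH; ring. Qed.

(** The mean over the upper half of the grid of level [N + 1], that is, over
    [1/2, 1), where the functions [f_n] with [n < N] are independent signs. *)
Definition rad_mean N P : R := (2 ^+ N)^-1 * \sum_(2 ^ N <= k < 2 ^ N.+1) P k.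

Lemma rad_mean0 P : rad_mean 0 P = P 1%N.
Proof. by rewrite /rad_mean expr0 invr1 mul1r big_nat1. Qed.

Lemma rad_meanS N P :
  rad_mean N.+1 P = rad_mean N (fun k => (P k.*2 + P k.*2.+1) / 2).
Proof.
rewrite /rad_mean [(2 ^ N.+2)%N]expn2S [in index_iota _ _](expn2S N) sum_nat_double.
by rewrite -mulr_suml expn2S exprS invfM; ring.
Qed.

Lemma eq_rad_mean N P Q : (forall k, (2 ^ N <= k)%N -> P k = Q k) ->
  rad_mean N P = rad_mean N Q.
Proof.
move=> PQ; rewrite /rad_mean; congr (_ * _).
by apply: eq_big_nat => k /andP[/PQ].
Qed.

Lemma ler_rad_mean N P Q : (forall k, P k <= Q k) -> rad_mean N P <= rad_mean N Q.
Proof.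
by move=> PQ; rewrite ler_wpM2l ?invr_ge0 ?exprn_ge0//; apply: ler_sum => k _.
Qed.

Lemma rad_meanD N P Q : rad_mean N (fun k => P k + Q k) = rad_mean N P + rad_mean N Q.
Proof. by rewrite /rad_mean big_split mulrDr. Qed.

Lemma rad_meanZ N c P : rad_mean N (fun k => c * P k) = c * rad_mean N P.
Proof. by rewrite /rad_mean -mulr_sumr mulrCA. Qed.

Lemma rad_mean_cst N c : rad_mean N (fun=> c) = c.
Proof.
elim: N => [|N IH]; first exact: rad_mean0.
by rewrite rad_meanS -[RHS]IH; apply: eq_rad_mean => k _; field.
Qed.

Lemma rad_mean_ge0 N P : (forall k, 0 <= P k) -> 0 <= rad_mean N P.
Proof. by move=> P0; rewrite -(rad_mean_cst N 0) ler_rad_mean. Qed.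

Lemma spiky_sum_even a N k : (2 ^ N <= k)%N ->
  spiky_sum a N.+1 k.*2 = spiky_sum a N k + a N.
Proof.
move=> Nk /=; rewrite doubleK /spiky expn2S leq_double Nk -muln2 exprM.
by rewrite sqrr_sign mulr1.
Qed.

Lemma spiky_sum_odd a N k : (2 ^ N <= k)%N ->
  spiky_sum a N.+1 k.*2.+1 = spiky_sum a N k - a N.
Proof.
move=> Nk /=; rewrite uphalf_double /spiky expn2S.
by rewrite leqW ?leq_double// exprS -muln2 exprM sqrr_sign mulr1 mulrN1.
Qed.

(** Independence of the last sign from the previous ones: the two children of a
    dyadic interval of [1/2, 1) carry opposite values of the last term. *)
Lemma rad_mean_recur (phi : R -> R -> R) a b N :
  rad_mean N.+1 (fun k => phi (spiky_sum a N.+1 k) (spiky_sum b N.+1 k)) =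
  rad_mean N (fun k => (phi (spiky_sum a N k + a N) (spiky_sum b N k + b N) +
                        phi (spiky_sum a N k - a N) (spiky_sum b N k - b N)) / 2).
Proof.
rewrite rad_meanS; apply: eq_rad_mean => k Nk.
by rewrite !spiky_sum_even// !spiky_sum_odd.
Qed.

Lemma spiky_sum0 a N : spiky_sum a N 0 = 0.
Proof.
by elim: N => [//|N IH] /=; rewrite IH /spiky leqNgt expn_gt0/= mulr0 addr0.
Qed.

(** On the lower half of the grid the only nonzero new value is at index one,
    the right child of index zero, where all the previous terms vanish. *)
Lemma spike_mean (phi : R -> R -> R) a b N : phi 0 0 = 0 ->
  (2 ^+ N.+1)^-1 *
    \sum_(0 <= k < 2 ^ N) phi (spiky_sum a N k) (spiky_sum b N k) =
  \sum_(n < N) (2 ^+ n.+2)^-1 * phi (a n * h n) (b n * h n).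
Proof.
move=> p0; elim: N => [|N IH]; first by rewrite big_nat1 big_ord0 /= p0 mulr0.
rewrite big_ord_recr -IH/= expn2S -[X in index_iota X]double0 sum_nat_double.
rewrite -(prednK (expn_gt0 2 N : (0 < 2 ^ N)%N)) !big_nat_recl//.
set m := (2 ^ N).-1.
rewrite [X in _ * (_ + X)](_ : _ = 2 * \sum_(0 <= k < m)
    phi (spiky_sum a N k.+1) (spiky_sum b N k.+1)); last first.
  rewrite mulr_sumr; apply: eq_big_nat => k /andP[_ km].
  have kN : (k.+2 <= 2 ^ N)%N by rewrite -(prednK (expn_gt0 2 N : (0 < 2 ^ N)%N)).
  rewrite doubleK (half_bit_double k.+1 true) /spiky.
  have -> : (2 ^ N.+1 <= k.+1.*2)%N = false by rewrite leqNgt expn2S ltn_double kN.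
  have -> : (2 ^ N.+1 <= k.+1.*2.+1)%N = false by rewrite leqNgt expn2S ltn_Sdouble kN.
  by rewrite /= !mulr0 !addr0 mulr_natl mulr2n.
rewrite /= double0 !spiky_sum0 /spiky.
have -> : (2 ^ N.+1 <= 0)%N = false by rewrite leqNgt expn_gt0.
have -> : (2 ^ N.+1 <= 1)%N = false by rewrite leqNgt (ltn_exp2l 0).
rewrite /= !mulr0 !addr0 !add0r p0 add0r !exprS !invfM.
by field.
Qed.

(** The spikes have disjoint supports, off the support of the Rademacher part,
    which occupies half of the unit interval. *)
Lemma avg_spiky (phi : R -> R -> R) a b N : phi 0 0 = 0 ->
  avg N.+1 (fun k => phi (spiky_sum a N k) (spiky_sum b N k)) =
  rad_mean N (fun k => phi (spiky_sum a N k) (spiky_sum b N k)) / 2 +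
  \sum_(n < N) (2 ^+ n.+2)^-1 * phi (a n * h n) (b n * h n).
Proof.
move=> p0; rewrite -(spike_mean a b N p0) /avg /rad_mean.
rewrite (@big_cat_nat _ _ _ (2 ^ N))//=; last by rewrite leq_exp2l.
by rewrite mulrDr addrC exprS invfM; congr (_ + _); ring.
Qed.

(** * Moments of Rademacher sums *)

Lemma rad_mean_mul a b N :
  rad_mean N (fun k => spiky_sum a N k * spiky_sum b N k) = \sum_(i < N) a i * b i.
Proof.
elim: N => [|N IH]; first by rewrite rad_mean0 big_ord0 mul0r.
rewrite (rad_mean_recur ( *%R)) big_ord_recr/= -IH.
rewrite -[X in _ + X](rad_mean_cst N) -rad_meanD.
by apply: eq_rad_mean => k _; field.
Qed.

(** Among the products [E r_i r_j r_k r_l] the pairings of equal indices survive;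
    the diagonal is counted in each of the three pairings, whence the
    correction term. *)
Lemma rad_mean_sqr_mul a b N :
  rad_mean N (fun k => spiky_sum a N k ^+ 2 * spiky_sum b N k ^+ 2) =
  (\sum_(i < N) a i ^+ 2) * (\sum_(i < N) b i ^+ 2)
  + 2 * (\sum_(i < N) a i * b i) ^+ 2 - 2 * \sum_(i < N) a i ^+ 2 * b i ^+ 2.
Proof.
elim: N => [|N IH]; first by rewrite rad_mean0 !big_ord0/=; ring.
rewrite (rad_mean_recur (fun x y => x ^+ 2 * y ^+ 2)) !big_ord_recr/=.
under eq_rad_mean => k _.
  rewrite (_ : _ / 2 = spiky_sum a N k ^+ 2 * spiky_sum b N k ^+ 2 +
    (b N ^+ 2 * (spiky_sum a N k * spiky_sum a N k) +
    (a N ^+ 2 * (spiky_sum b N k * spiky_sum b N k) +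
    (4 * a N * b N * (spiky_sum a N k * spiky_sum b N k) +
     a N ^+ 2 * b N ^+ 2)))); last by field.
  over.
rewrite !rad_meanD !rad_meanZ rad_mean_cst IH !rad_mean_mul.
under [X in b N ^+ 2 * X]eq_bigr do rewrite -expr2.
under [X in a N ^+ 2 * X]eq_bigr do rewrite -expr2.
ring.
Qed.

(** Only the inequality [1 + x <= expR x] is used, at [x] and at [- x]; the
    right-hand side is chosen because products of such factors are controlled by
    [1 - s - t <= (1 - s) * (1 - t)]. *)
Lemma cosh_le (x : R) : x ^+ 2 < 1 -> (expR x + expR (- x)) / 2 <= (1 - x ^+ 2)^-1.
Proof.
move=> x1; have /andP[xl xr] : (-1 < x) && (x < 1).
  by rewrite -ltr_norml -(ltr_pXn2r (n := 2))// ?nnegrE// expr1n real_normK ?num_real.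
have e1 : expR x <= (1 - x)^-1.
  rewrite -[expR x]invrK -expRN lef_pV2 ?posrE ?expR_gt0 ?subr_gt0//.
  exact: expR_ge1Dx.
have e2 : expR (- x) <= (1 + x)^-1.
  rewrite expRN lef_pV2 ?posrE ?expR_gt0//; first exact: expR_ge1Dx.
  by lra.
have -> : (1 - x ^+ 2)^-1 = ((1 - x)^-1 + (1 + x)^-1) / 2.
  by field; rewrite !gt_eqF// ?subr_gt0//; lra.
by rewrite ler_pM2r// lerD.
Qed.

(** The mean is a product of hyperbolic cosines. The bound [1 / 2] on the sum of
    squares keeps [1 - sum a_i^2] away from zero. *)
Lemma rad_mean_expR a N : \sum_(i < N) a i ^+ 2 <= 1 / 2 ->
  rad_mean N (fun k => expR (spiky_sum a N k)) <= 2.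
Proof.
move=> s12; suff /(_ s12) : \sum_(i < N) a i ^+ 2 <= 1 / 2 ->
    rad_mean N (fun k => expR (spiky_sum a N k)) * (1 - \sum_(i < N) a i ^+ 2) <= 1.
  set E := rad_mean _ _; set S := \sum_(i < N) _ in s12 *.
  have E0 : 0 <= E by apply: rad_mean_ge0 => k; exact: expR_ge0.
  by nra.
elim: N {s12} => [_|N IH].
  by rewrite rad_mean0 big_ord0 /= expR0 subr0 mul1r.
rewrite (rad_mean_recur (fun y _ => expR y) a a) big_ord_recr/=.
set S := \sum_(i < N) _ in IH *; move: (a N) => x s12.
have S0 : 0 <= S by apply: sumr_ge0 => i _; exact: sqr_ge0.
have x0 := sqr_ge0 x.
have /IH {}IH : S <= 1 / 2 by lra.
set E := rad_mean N _ in IH.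
have E0 : 0 <= E by apply: rad_mean_ge0 => k; exact: expR_ge0.
under eq_rad_mean => k _.
  rewrite !expRD -mulrDr -mulrA mulrC; over.
rewrite rad_meanZ -/E; move: E E0 IH => E E0 IH.
have cx : (expR x + expR (- x)) / 2 <= (1 - x ^+ 2)^-1 by apply: cosh_le; lra.
apply: (@le_trans _ _ ((1 - x ^+ 2)^-1 * E * (1 - (S + x ^+ 2)))).
  by rewrite !ler_wpM2r//; lra.
have x1 : 0 < 1 - x ^+ 2 by lra.
rewrite -(ler_pM2l x1) mulr1 !mulrA mulfV ?mul1r ?gt_eqF//.
move: (x ^+ 2) x0 x1 => X X0 X1.
have ESX : 0 <= E * (S * X) by rewrite !mulr_ge0//.
have : E * (1 - S) * (1 - X) <= 1 - X by rewrite ler_piMl// ltW.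
lra.
Qed.

(** This is [t <= expR t] at [t = x / s], raised to the power [s]. *)
Lemma powR_le_expR (s x : R) : 0 < s -> 0 <= x -> x `^ s <= s `^ s * expR x.
Proof.
move=> s0 x0; have xs0 : 0 <= x / s by rewrite divr_ge0// ltW.
have e : expR x = expR (x / s) `^ s by rewrite -expRM divfK ?gt_eqF.
rewrite e -powRM ?expR_ge0 ?(ltW s0)// ge0_ler_powR ?nnegrE ?mulr_ge0 ?expR_ge0 ?(ltW s0)//.
rewrite mulrC -ler_pdivrMr// (le_trans _ (expR_ge1Dx _))// lerDr//.
Qed.

(** Khintchine's upper inequality, from exponential moments. *)
Lemma rad_mean_powR s a N : 0 < s -> \sum_(i < N) a i ^+ 2 <= 1 / 2 ->
  rad_mean N (fun k => `|spiky_sum a N k| `^ s) <= 4 * s `^ s.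
Proof.
move=> s0 a12.
apply: (@le_trans _ _ (s `^ s * (rad_mean N (fun k => expR (spiky_sum a N k)) +
    rad_mean N (fun k => expR (spiky_sum (fun n => -1 * a n) N k))))).
  rewrite -rad_meanD -rad_meanZ; apply: ler_rad_mean => k.
  rewrite spiky_sumZ mulN1r (le_trans (powR_le_expR s0 (normr_ge0 _)))//.
  rewrite ler_wpM2l ?powR_ge0//; case: ger0P => _.
    by rewrite lerDl expR_ge0.
  by rewrite lerDr expR_ge0.
rewrite mulrC ler_wpM2r ?powR_ge0//.
have -> : (4 : R) = 2 + 2 by ring.
rewrite lerD// rad_mean_expR//.
by under eq_bigr do rewrite mulN1r sqrrN.
Qed.

(** Two Rademacher sums can be nearly disjoint only if some coordinate is large
    in both: otherwise the negative term of the fourth moment identity is at most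
    [2 * (1 / 4)^2 * (sum a_i^2 + sum b_i^2) = 1 / 8], half of the leading term. *)
Lemma rad_mean_sqr_mul_ge a b N :
  \sum_(i < N) a i ^+ 2 = 1 / 2 -> \sum_(i < N) b i ^+ 2 = 1 / 2 ->
  (forall i, (i < N)%N -> Num.min `|a i| `|b i| <= 1 / 4) ->
  1 / 8 <= rad_mean N (fun k => spiky_sum a N k ^+ 2 * spiky_sum b N k ^+ 2).
Proof.
move=> a2 b2 ab; rewrite rad_mean_sqr_mul a2 b2.
have : \sum_(i < N) a i ^+ 2 * b i ^+ 2 <=
    1 / 16 * (\sum_(i < N) a i ^+ 2 + \sum_(i < N) b i ^+ 2).
  rewrite -big_split mulr_sumr /=; apply: ler_sum => i _.
  have := ab _ (ltn_ord i); rewrite ge_min.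
  rewrite -(real_normK (num_real (a i))) -(real_normK (num_real (b i))).
  move: (normr_ge0 (a i)) (normr_ge0 (b i)).
  move: `|a i| `|b i| => x y x0 y0 /orP[]xy.
    have : x ^+ 2 <= 1 / 16 by nra.
    by move: (sqr_ge0 x) (sqr_ge0 y); move: (x ^+ 2) (y ^+ 2) => X Y; nra.
  have : y ^+ 2 <= 1 / 16 by nra.
  by move: (sqr_ge0 x) (sqr_ge0 y); move: (x ^+ 2) (y ^+ 2) => X Y; nra.
have := sqr_ge0 (\sum_(i < N) a i * b i); rewrite a2 b2; lra.
Qed.

(** A pointwise substitute for Hoelder's inequality, used to pass from the mean
    of [X^2 Y^2] to that of [min(|X|, |Y|)^p]. Where the maximum is at most
    [sqrt T], the product is at most [T] times the squared minimum, which is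
    either below [eta] or dominated by a multiple of its [p]-th power;
    elsewhere the sixth powers dominate, with the small factor [1 / T]. *)
Lemma sqr_mul_le_min (x y T eta p : R) : 0 <= x -> 0 <= y -> 0 < T ->
  0 < eta -> eta <= 1 -> 2 <= p ->
  x ^+ 2 * y ^+ 2 <=
    T * (eta + eta `^ (- p) * Num.min x y `^ p) + T^-1 * (x ^+ 6 + y ^+ 6).
Proof.
wlog xy : x y / x <= y.
  move=> wl x0 y0; have /orP[/wl|/wl] := le_total x y; first by move=> /(_ x0 y0).
  by move=> /(_ y0 x0); rewrite minC mulrC [y ^+ 6 + _]addrC.
move=> x0 y0 T0 e0 e1 p2; rewrite min_l//.
have w2 : x ^+ 2 <= eta + eta `^ (- p) * x `^ p.
  have p0 : 0 <= p by rewrite (le_trans _ p2).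
  have [xe|xe] := leP x eta.
    apply: (@le_trans _ _ eta); last by rewrite lerDl mulr_ge0 ?powR_ge0.
    by nra.
  have -> : eta `^ (- p) * x `^ p = (x / eta) `^ p.
    have -> : x `^ p = (x / eta) `^ p * eta `^ p.
      by rewrite -powRM ?divfK ?gt_eqF// ?divr_ge0// ltW.
    by rewrite powRN mulrCA mulVf ?mulr1// gt_eqF// powR_gt0.
  apply: (@le_trans _ _ ((x / eta) `^ p)); last by rewrite lerDr ltW.
  have xe1 : 1 <= x / eta by rewrite ler_pdivlMr// mul1r ltW.
  apply: (@le_trans _ _ ((x / eta) `^ 2)); last by rewrite ler_powR.
  have xe0 : 0 <= x / eta by rewrite (le_trans _ xe1).
  by rewrite powR_mulrn// ler_pXn2r ?nnegrE// ler_pdivlMr// ler_piMr.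
have Ti : 0 < T^-1 by rewrite invr_gt0.
have W0 := sqr_ge0 x; have M0 := sqr_ge0 y.
have x6 : 0 <= x ^+ 6 by rewrite exprn_ge0.
have y6 : 0 <= y ^+ 6 by rewrite exprn_ge0.
have [yT|/ltW yT] := leP (y ^+ 2) T.
  rewrite (@le_trans _ _ (T * x ^+ 2))//; first by rewrite mulrC ler_wpM2r.
  rewrite (@le_trans _ _ (T * (eta + eta `^ (- p) * x `^ p)))//.
    by rewrite ler_pM2l.
  by rewrite lerDl mulr_ge0 ?addr_ge0// ltW.
rewrite (@le_trans _ _ (T^-1 * y ^+ 6))//.
  have xy2 : x ^+ 2 <= y ^+ 2 by rewrite ler_pXn2r// nnegrE.
  rewrite ler_pdivlMl// (_ : y ^+ 6 = y ^+ 2 * (y ^+ 2 * y ^+ 2)); last by ring.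
  by rewrite ler_pM ?mulr_ge0 ?(ltW T0)// ler_wpM2r.
rewrite (@le_trans _ _ (T^-1 * (x ^+ 6 + y ^+ 6)))//.
  by rewrite ler_pM2l// lerDr.
by rewrite lerDr mulr_ge0 ?(ltW T0)// addr_ge0 ?(ltW e0)// mulr_ge0 ?powR_ge0.
Qed.

End spiky_rademacher.

(** * Overlap estimates for spiky Rademacher sums *)

Section avg_lemmas.
Context {R : realType}.
Implicit Types (N : nat) (G H : nat -> R).

Lemma ler_avg N G H : (forall k, G k <= H k) -> avg N G <= avg N H.
Proof.
by move=> GH; rewrite ler_wpM2l ?invr_ge0 ?exprn_ge0//; apply: ler_sum => k _.
Qed.

Lemma avg_eq0 N G : (forall k, G k = 0) -> avg N G = 0.
Proof. by move=> G0; rewrite /avg big1 ?mulr0. Qed.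

Lemma avg_ge0 N G : (forall k, 0 <= G k) -> 0 <= avg N G.
Proof. by move=> G0; rewrite -(avg_eq0 N (G := fun=> 0))// ler_avg. Qed.

Lemma avgZ N c G : avg N (fun k => c * G k) = c * avg N G.
Proof. by rewrite /avg -mulr_sumr mulrCA. Qed.

(** The L_q norm of [step N G]. *)
Definition pnorm (q : R) N G : R := (avg N (fun k => `|G k| `^ q)) `^ q^-1.

Lemma pnorm_ge0 q N G : 0 <= pnorm q N G.
Proof. exact: powR_ge0. Qed.

Lemma eq_pnorm q N G H : G =1 H -> pnorm q N G = pnorm q N H.
Proof. by move=> /funext ->. Qed.

Lemma ler_pnorm q N G H : 0 <= q -> (forall k, `|G k| <= `|H k|) ->
  pnorm q N G <= pnorm q N H.
Proof.
move=> q0 GH; rewrite ge0_ler_powR ?invr_ge0// ?nnegrE.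
- by apply: avg_ge0 => k; exact: powR_ge0.
- by apply: avg_ge0 => k; exact: powR_ge0.
- by apply: ler_avg => k; rewrite ge0_ler_powR ?nnegrE.
Qed.

Lemma pnormZ q N c G : 0 < q -> 0 <= c ->
  pnorm q N (fun k => c * G k) = c * pnorm q N G.
Proof.
move=> q0 c0; rewrite /pnorm.
rewrite (_ : avg N _ = c `^ q * avg N (fun k => `|G k| `^ q)); last first.
  rewrite -avgZ; congr avg; apply/funext => k.
  by rewrite normrM (ger0_norm c0) powRM.
rewrite powRM ?powR_ge0//; last by apply: avg_ge0 => k; exact: powR_ge0.
by rewrite -powRrM mulfV ?gt_eqF// powRr1.
Qed.

End avg_lemmas.

Section overlap.
Context {R : realType} (p : R) (p2 : 2 <= p).
Implicit Types (N n k : nat) (a b : nat -> R).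

Let p0 : 0 < p. Proof. by rewrite (lt_le_trans _ p2). Qed.

(** The spike of index [n] has length [2^-(n+2)] and norm one in L_p. *)
Definition spike_height n : R := (2 ^+ n.+2) `^ p^-1.

Local Notation U := (spiky_sum spike_height).

Lemma spike_height_ge0 n : 0 <= spike_height n.
Proof. exact: powR_ge0. Qed.

Lemma spike_weight n (x : R) :
  (2 ^+ n.+2)^-1 * `|x * spike_height n| `^ p = `|x| `^ p.
Proof.
rewrite normrM (ger0_norm (spike_height_ge0 n)) powRM ?spike_height_ge0//.
rewrite /spike_height -powRrM mulVf ?gt_eqF// powRr1// mulrCA mulVf ?mulr1//.
Qed.

Lemma coef_le1 a N i : \sum_(i < N) a i ^+ 2 = 1 / 2 -> (i < N)%N -> `|a i| <= 1.
Proof.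
move=> a2 iN; rewrite -(@expr_le1 _ 2)// real_normK ?num_real//.
apply: (@le_trans _ _ (\sum_(i < N) a i ^+ 2)); last by rewrite a2; lra.
rewrite (bigD1 (Ordinal iN))//= lerDl.
by apply: sumr_ge0 => j _; exact: sqr_ge0.
Qed.

(** The spikes are summable in the required sense because [p >= 2] and the
    coefficients are at most one, so that [|a_i|^p <= a_i^2]. *)
Lemma avg_powR_le a N : \sum_(i < N) a i ^+ 2 = 1 / 2 ->
  avg N.+1 (fun k => `|U a N k| `^ p) <= 2 * p `^ p + 1 / 2.
Proof.
move=> a2; have a2' : \sum_(i < N) a i ^+ 2 <= 1 / 2 by rewrite a2.
rewrite (avg_spiky (phi := fun x _ => `|x| `^ p) _ a a); last first.
  by rewrite normr0 powR0// gt_eqF.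
rewrite lerD//.
  by have := rad_mean_powR spike_height p0 a2'; lra.
rewrite -a2; apply: ler_sum => i _; rewrite spike_weight -real_normK ?num_real//.
rewrite -powR_mulrn//.
have [->|ai0] := eqVneq `|a i| 0.
  by rewrite !powR0 ?gt_eqF.
by rewrite ger_powR// lt_def ai0 normr_ge0 (coef_le1 a2).
Qed.

(** If some coordinate is at least [1 / 4] in both families, its spike is shared.
    Otherwise the Rademacher parts have [E X^2 Y^2 >= 1 / 8]. *)
Lemma min_overlap : exists2 c, 0 < c & forall a b N,
  \sum_(i < N) a i ^+ 2 = 1 / 2 -> \sum_(i < N) b i ^+ 2 = 1 / 2 ->
  c <= avg N.+1 (fun k => `|Num.min `|U a N k| `|U b N k| | `^ p).
Proof.
(* [K] bounds the sixth moments; [T] makes their share at most [1 / 16], and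
   [eta] makes the share of the constant term [1 / 32], out of [1 / 8]. *)
pose K : R := 4 * 6 `^ 6; pose T := 32 * K; pose eta := (32 * T)^-1.
have K1 : 1 <= K.
  rewrite /K powR_mulrn//; have : (1 : R) <= 6 ^+ 6 by rewrite exprn_ege1//; lra.
  lra.
have T0 : 0 < T by rewrite /T; lra.
have e0 : 0 < eta by rewrite invr_gt0; lra.
have e1 : eta <= 1 by rewrite invf_le1 /T; lra.
pose c1 := 1 / 32 / (T * eta `^ (- p)) / 2.
have c10 : 0 < c1 by rewrite !divr_gt0// mulr_gt0// powR_gt0.
exists (Num.min c1 ((1 / 4) `^ p)); first by rewrite lt_min c10 powR_gt0//; lra.
move=> a b N a2 b2.
have mp0 k : 0 <= Num.min `|U a N k| `|U b N k| by rewrite le_min !normr_ge0.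
rewrite (avg_spiky (phi := fun x y => `|Num.min `|x| `|y| | `^ p) _ a b); last first.
  by rewrite normr0 minxx normr0 powR0// gt_eqF.
have [[i iN abi]|small] := pselect
    (exists2 i, (i < N)%N & 1 / 4 <= Num.min `|a i| `|b i|).
  rewrite ge_min; apply/orP; right.
  apply: ler_wpDl; first by rewrite divr_ge0// rad_mean_ge0// => k; exact: powR_ge0.
  rewrite (bigD1 (Ordinal iN))//= ler_wpDr//.
    by apply: sumr_ge0 => j _; rewrite mulr_ge0 ?powR_ge0// invr_ge0 exprn_ge0.
  rewrite !normrM !(ger0_norm (spike_height_ge0 i)) -minr_pMl ?spike_height_ge0//.
  rewrite spike_weight ge0_ler_powR ?nnegrE ?(ltW p0)//.
  by rewrite (le_trans abi)// ler_norm.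
rewrite ge_min; apply/orP; left.
apply: ler_wpDr.
  by apply: sumr_ge0 => j _; rewrite mulr_ge0 ?powR_ge0// invr_ge0 exprn_ge0.
have := rad_mean_sqr_mul_ge spike_height a2 b2.
have /[swap]/[apply] : forall i, (i < N)%N -> Num.min `|a i| `|b i| <= 1 / 4.
  move=> i iN; rewrite leNgt; apply/negP => /ltW abi.
  by apply: small; exists i.
set w := fun k => Num.min `|U a N k| `|U b N k|.
have bound k : U a N k ^+ 2 * U b N k ^+ 2 <=
    T * eta + (T * eta `^ (- p) * (`|w k| `^ p) +
      T^-1 * (`|U a N k| `^ 6 + `|U b N k| `^ 6)).
  have := sqr_mul_le_min (normr_ge0 (U a N k)) (normr_ge0 (U b N k)) T0 e0 e1 p2.
  rewrite !real_normK ?num_real// !powR_mulrn// (ger0_norm (mp0 k)) -/(w k); lra.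
move=> /le_trans/(_ (ler_rad_mean N bound)).
rewrite !(rad_meanD, rad_meanZ) rad_mean_cst.
have a2' : \sum_(i < N) a i ^+ 2 <= 1 / 2 by rewrite a2.
have b2' : \sum_(i < N) b i ^+ 2 <= 1 / 2 by rewrite b2.
have six : (0 : R) < 6 by lra.
have := rad_mean_powR spike_height six a2'.
have := rad_mean_powR spike_height six b2'.
rewrite -/K; set B := rad_mean _ _; set A := rad_mean _ _.
set W := rad_mean N (fun k => `|w k| `^ p) => BK AK.
have : T^-1 * (A + B) <= 1 / 16.
  rewrite ler_pdivrMl// /T; lra.
have -> : T * eta = 1 / 32 by rewrite /eta; field; rewrite gt_eqF.
move=> AB le1; rewrite /c1 ler_pM2r ?invr_gt0// ler_pdivrMr ?mulr_gt0 ?powR_gt0//.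
rewrite mulrC; lra.
Qed.

Lemma spiky_sum_eq0 a N k : (forall i, (i < N)%N -> a i = 0) -> U a N k = 0.
Proof.
elim: N k => [//|N IH] k a0 /=; rewrite a0// mul0r addr0 IH// => i iN.
by rewrite a0// ltnW.
Qed.

Lemma spiky_sum_normalize a N : (forall k, U a N k = 0) \/
  exists2 c : R, 0 < c & exists2 a' : nat -> R, \sum_(i < N) a' i ^+ 2 = 1 / 2 &
    forall k, U a N k = c * U a' N k.
Proof.
set S := \sum_(i < N) a i ^+ 2.
have S0 : 0 <= S by apply: sumr_ge0 => i _; exact: sqr_ge0.
have [Sz|S1] := eqVneq S 0.
  left => k; apply: spiky_sum_eq0 => i iN.
  move/eqP: Sz; rewrite psumr_eq0 => [/allP/(_ (Ordinal iN))|j _]; last exact: sqr_ge0.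
  by rewrite mem_index_enum /= sqrf_eq0 => /(_ isT)/eqP.
right; pose c := Num.sqrt (2 * S).
have c0 : 0 < c by rewrite sqrtr_gt0 mulr_gt0// lt_def S1.
exists c => //; exists (fun i => c^-1 * a i); last first.
  by move=> k; rewrite spiky_sumZ mulrA mulfV ?mul1r// gt_eqF.
under eq_bigr do rewrite exprMn exprVn sqr_sqrtr ?mulr_ge0//.
by rewrite -mulr_sumr -/S; field.
Qed.

(** Both sides scale with the smaller of the two l_2 norms: shrinking the larger
    family to that size only decreases the minimum on the right, and on the left
    only the smaller norm matters. *)
Lemma overlap_stable : exists2 C, 0 <= C & forall a b N,
  Num.min (pnorm p N.+1 (U a N)) (pnorm p N.+1 (U b N)) <=
  C * pnorm p N.+1 (fun k => Num.min `|U a N k| `|U b N k|).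
Proof.
have [c c0 cP] := min_overlap.
pose K : R := 2 * p `^ p + 1 / 2.
have K0 : 0 <= K by have := powR_ge0 p p; rewrite /K; lra.
exists (K `^ p^-1 / c `^ p^-1); first by rewrite divr_ge0 ?powR_ge0.
move=> a b N.
have nz x : (forall k, U x N k = 0) -> pnorm p N.+1 (U x N) = 0.
  move=> x0; rewrite /pnorm avg_eq0 => [|k].
    by rewrite powR0 ?gt_eqF ?invr_gt0.
  by rewrite x0 normr0 powR0// gt_eqF.
have rhs0 : 0 <= K `^ p^-1 / c `^ p^-1 *
    pnorm p N.+1 (fun k => Num.min `|U a N k| `|U b N k|).
  by rewrite mulr_ge0 ?pnorm_ge0// divr_ge0 ?powR_ge0.
have [/nz a0|[A A0 [a' a2 aE]]] := spiky_sum_normalize a N; first by rewrite ge_min a0 rhs0.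
have [/nz b0|[B B0 [b' b2 bE]]] := spiky_sum_normalize b N; first by rewrite ge_min b0 rhs0 orbT.
have up (x : nat -> R) : \sum_(i < N) x i ^+ 2 = 1 / 2 -> pnorm p N.+1 (U x N) <= K `^ p^-1.
  move=> /avg_powR_le xK; rewrite ge0_ler_powR ?nnegrE ?invr_ge0 ?(ltW p0)//.
  by apply: avg_ge0 => k; exact: powR_ge0.
have lo : c `^ p^-1 <= pnorm p N.+1 (fun k => Num.min `|U a' N k| `|U b' N k|).
  rewrite ge0_ler_powR ?nnegrE ?invr_ge0 ?(ltW p0) ?(ltW c0)//; last exact: cP.
  by apply: avg_ge0 => k; exact: powR_ge0.
pose l := Num.min A B; have l0 : 0 < l by rewrite lt_min A0 B0.
apply: (@le_trans _ _ (l * K `^ p^-1)).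
  rewrite (eq_pnorm _ _ aE) (eq_pnorm _ _ bE) !pnormZ ?(ltW A0) ?(ltW B0)//.
  have [->|->] : l = A \/ l = B by rewrite /l; case: leP; [left|right].
    by rewrite ge_min; apply/orP; left; rewrite ler_wpM2l ?(ltW A0)// up.
  by rewrite ge_min; apply/orP; right; rewrite ler_wpM2l ?(ltW B0)// up.
have [lA lB] : l <= A /\ l <= B by rewrite /l !ge_min !lexx orbT.
move: l l0 lA lB => l l0 lA lB.
rewrite -mulrA [l * _]mulrC ler_wpM2l ?powR_ge0//.
rewrite ler_pdivlMl; last exact: powR_gt0.
rewrite mulrC; apply: (@le_trans _ _
    (l * pnorm p N.+1 (fun k => Num.min `|U a' N k| `|U b' N k|))).
  by rewrite ler_pM2l.
rewrite -pnormZ; [|exact: p0|exact: ltW].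
apply: ler_pnorm; first exact: ltW.
move=> k; rewrite aE bE !normrM (gtr0_norm A0) (gtr0_norm B0) (gtr0_norm l0).
have [x0 y0] := (normr_ge0 (U a' N k), normr_ge0 (U b' N k)).
move: `|U a' N k| `|U b' N k| x0 y0 => x y x0 y0.
rewrite !ger0_norm ?le_min ?mulr_ge0 ?x0 ?y0 ?(ltW A0) ?(ltW B0)//.
by rewrite !ler_pM ?(ltW l0) ?le_min ?ge_min ?lexx ?x0 ?y0 ?orbT.
Qed.

(** * Two spiky Rademacher functions in smaller exponents *)

Lemma spiky_abs n k : (2 ^ n.+1 <= k)%N -> `|spiky spike_height n k| = 1.
Proof. by move=> nk; rewrite /spiky nk normrX normrN1 expr1n. Qed.

Definition unit_coef n i : R := (i == n)%:R.

Lemma unit_sum n k : U (unit_coef n) n.+1 k = spiky spike_height n k.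
Proof.
rewrite /= spiky_sum_eq0 => [|i iN]; rewrite /unit_coef ?eqxx ?mul1r ?add0r//.
by rewrite ltn_eqF.
Qed.

(** On [1/2, 1) both moduli are one, so only the two spikes contribute. *)
Lemma overlap_decay q n : 0 < q ->
  avg n.+3 (fun k =>
    `| `|U (unit_coef n) n.+2 k| - `|U (unit_coef n.+1) n.+2 k| | `^ q) =
  (2 `^ (q / p - 1)) ^+ n.+2 + (2 `^ (q / p - 1)) ^+ n.+3.
Proof.
move=> q0; have z : `| `|0 : R| - `|0 : R| | `^ q = 0.
  by rewrite subrr normr0 powR0// gt_eqF.
rewrite (avg_spiky (phi := fun x y => `| `|x| - `|y| | `^ q) _ (unit_coef n) (unit_coef n.+1))//.
rewrite (_ : rad_mean _ _ = 0) ?mul0r ?add0r; last first.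
  rewrite -[RHS](rad_mean_cst n.+2); apply: eq_rad_mean => k nk.
  rewrite unit_sum spiky_abs// -[n.+2]/(n.+1.+1) [U (unit_coef n) _ _]/= -/(U _ _).
  rewrite -[_ + _ * spiky _ n _]/(U (unit_coef n) n.+1 k./2) unit_sum.
  rewrite [unit_coef n n.+1]/unit_coef gtn_eqF// mul0r addr0 spiky_abs.
    by rewrite subrr normr0 powR0// gt_eqF.
  by have := half_leq nk; rewrite expn2S doubleK.
rewrite 2!big_ord_recr big1 ?add0r => [|i _]; last first.
  have i1 := ltn_ord i; rewrite /unit_coef/= (ltn_eqF i1).
  by rewrite (ltn_eqF (ltn_trans i1 (ltnSn n))) !mul0r z mulr0.
rewrite /unit_coef /= !eqxx (gtn_eqF (ltnSn n)) (ltn_eqF (ltnSn n)) !mul0r !mul1r normr0 subr0 sub0r.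
rewrite normrN !normr_id !(ger0_norm (spike_height_ge0 _)).
have w m : (2 ^+ m)^-1 * ((2 ^+ m) `^ p^-1) `^ q = (2 `^ (q / p - 1)) ^+ m :> R.
  rewrite -powRrM -!powR_mulrn ?powR_ge0// -powRN -!powRrM -powRD; last first.
    by rewrite pnatr_eq0 implybT.
  by congr (_ `^ _); ring.
by rewrite /spike_height add0r !w.
Qed.

(** On [1/2, 1) the last sign is independent of the other term, and of the two
    numbers [x + e] and [x - e] at least one has modulus at least one. *)
Lemma separation q n (e : R) : 1 <= q -> `|e| = 1 ->
  1 / 4 <= avg n.+3 (fun k =>
    `|U (unit_coef n) n.+2 k + e * U (unit_coef n.+1) n.+2 k| `^ q).
Proof.
move=> q1 e1; have q0 : 0 < q by rewrite (lt_le_trans _ q1).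
rewrite (avg_spiky (phi := fun x y => `|x + e * y| `^ q) _ (unit_coef n) (unit_coef n.+1)); last first.
  by rewrite mulr0 addr0 normr0 powR0// gt_eqF.
apply: ler_wpDr.
  by apply: sumr_ge0 => j _; rewrite mulr_ge0 ?powR_ge0// invr_ge0 exprn_ge0.
rewrite (rad_mean_recur _ (fun x y => `|x + e * y| `^ q)).
rewrite [1 / 4](_ : _ = 1 / 2 / 2); last by field.
rewrite ler_pM2r// -[leLHS](rad_mean_cst n.+1) ler_rad_mean// => k.
rewrite ler_pM2r// /unit_coef gtn_eqF// eqxx.
move: (U _ _ _) (U _ _ _) => y x; rewrite mulr1n addr0 subr0.
set s := x + e * (y + 1); set t := x + e * (y - 1).
have st : 2 <= `|s| + `|t|.
  rewrite -(normrN t) (le_trans _ (ler_normD _ _))//.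
  rewrite (_ : s - t = e * 2); last by rewrite /s /t; ring.
  by rewrite normrM e1 mul1r ger0_norm.
have big (z : R) : 1 <= `|z| -> 1 <= `|z| `^ q.
  by move=> z1; rewrite (le_trans z1)// le1r_powR.
have [/big s1|s1] := leP 1 `|s|.
  by rewrite (le_trans s1)// lerDl powR_ge0.
have /big t1 : 1 <= `|t| by lra.
by rewrite (le_trans t1)// lerDr powR_ge0.
Qed.

End overlap.

(** * Closures of subspaces *)

Section closure_submod.
Context {R : realType} {V : normedModType R}.
Implicit Types F : set V.

Lemma closure_ltP F (x : V) :
  closure F x <-> forall e : R, 0 < e -> exists2 y, F y & `|x - y| < e.
Proof.
split=> [cx e e0|cx B].
  have [y [Fy xy]] := cx _ (nbhsx_ballx x e e0).
  by exists y => //; move: xy; rewrite -ball_normE.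
rewrite -nbhs_ballE => -[e e0 eB]; have [y Fy xy] := cx _ e0.
by exists y; split => //; apply: eB; rewrite -ball_normE.
Qed.

Lemma closure_submod F : F 0 ->
  (forall c x y, F x -> F y -> F (c *: x + y)) -> submod_closed [in closure F].
Proof.
move=> F0 FD; split=> [|c x y]; rewrite !inE.
  exact: subset_closure.
move=> /closure_ltP cx /closure_ltP cy; apply/closure_ltP => e e0.
have c0 : 0 < 2 * (`|c| + 1) by rewrite mulr_gt0// ltr_wpDl.
have [x' Fx' xx'] := cx _ (divr_gt0 e0 c0).
have e20 : 0 < e / 2 by rewrite divr_gt0.
have [y' Fy' yy'] := cy _ e20.
exists (c *: x' + y'); first exact: FD.
rewrite opprD addrACA -scalerBr (le_lt_trans (ler_normD _ _))//.
rewrite [ltRHS]splitr ler_ltD// normrZ.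
rewrite (@le_trans _ _ ((`|c| + 1) * (e / (2 * (`|c| + 1)))))//.
  by rewrite ler_pM ?lerDl// ltW.
by rewrite le_eqVlt; apply/orP; left; apply/eqP; field; rewrite gt_eqF// ltr_wpDl.
Qed.

End closure_submod.

(** * Lebesgue norms and closures under stable phase retrieval *)

Section Lspace_facts.
Context d (T : measurableType d) (R : realType) (mu : {measure set T -> \bar R}).
Context (r : R) (r1 : (1 <= r%:E)%E).
Local Notation L := (LspaceType mu r1).

Let r0 : 0 < r. Proof. by rewrite -lte_fin (lt_le_trans _ r1)// lte_fin. Qed.

Lemma Lnorm_ae_le (f g : T -> R) :
  measurable_fun [set: T] f -> measurable_fun [set: T] g ->
  {ae mu, forall x, `|f x| <= `|g x|} ->
  ('N[mu]_(r%:E)[EFin \o f] <= 'N[mu]_(r%:E)[EFin \o g])%E.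
Proof.
move=> mf mg fg; rewrite unlock.
have mpow (h : T -> R) : measurable_fun [set: T] h ->
    measurable_fun [set: T] (fun x => (`|(EFin \o h) x| `^ r)%E).
  move=> mh; apply: (@measurableT_comp _ _ _ _ _ _ (fun x => x `^ r)%E).
    exact: measurable_poweR.
  by apply: measurableT_comp => //; exact/measurable_EFinP.
apply: gt0_ler_poweR.
- by rewrite invr_ge0 ltW.
- by rewrite in_itv /= leey andbT integral_ge0// => x _; exact: poweR_ge0.
- by rewrite in_itv /= leey andbT integral_ge0// => x _; exact: poweR_ge0.
apply: ae_ge0_le_integral => //.
- by move=> x _; exact: poweR_ge0.
- exact: mpow.
- by move=> x _; exact: poweR_ge0.
- exact: mpow.
apply: filterS fg => x fgx _ /=.
by rewrite lee_fin ge0_ler_powR ?nnegrE// ltW.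
Qed.

Lemma ler_Lspace_norm (f g : L) :
  {ae mu, forall x, `|Lrepr f x| <= `|Lrepr g x|} -> `|f| <= `|g|.
Proof.
move=> fg; rewrite -lee_fin !Lspace_normE.
by apply: Lnorm_ae_le => //; exact: measurable_Lrepr.
Qed.

Lemma Lspace_norm_ae (f : L) (g : T -> R) :
  measurable_fun [set: T] g -> Lrepr f = g %[ae mu] ->
  `|f|%:E = ('N[mu]_(r%:E)[EFin \o g])%E.
Proof.
move=> mg fg; rewrite Lspace_normE; apply: ae_eq_Lnorm => //.
exact: measurable_Lrepr.
Qed.

Lemma LreprB (f g : L) : Lrepr (f - g) = (fun x => Lrepr f x - Lrepr g x) %[ae mu].
Proof.
move: (LreprD f (- g)) (LreprN g); apply: filterS2 => x /(_ I) E1 /(_ I) E2 _.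
by rewrite E1 E2.
Qed.

Lemma LreprB_abs (f g : L) :
  Lrepr (Labs f - Labs g) = (fun x => `|Lrepr f x| - `|Lrepr g x|) %[ae mu].
Proof.
move: (LreprB (Labs f) (Labs g)) (Lrepr_abs f) (Lrepr_abs g).
by apply: filterS3 => x /(_ I) E1 /(_ I) E2 /(_ I) E3 _; rewrite E1 E2 E3.
Qed.

(** The modulus is continuous on L_r, so the two sides of the phase retrieval
    inequality are continuous in [f] and [g]. *)
Lemma Labs_lipschitz (f g : L) : `|Labs f - Labs g| <= `|f - g|.
Proof.
apply: ler_Lspace_norm; move: (LreprB_abs f g) (LreprB f g).
apply: filterS2 => x /(_ I) E1 /(_ I) E2; rewrite E1 E2.
exact: ler_dist_dist.
Qed.

Lemma closure_stable_phase_retrieval (F : set L) (C : R) : 0 <= C ->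
  (forall f g, F f -> F g ->
     Num.min `|f - g| `|f + g| <= C * `|Labs f - Labs g|) ->
  stable_phase_retrieval (closure F).
Proof.
move=> C0 FC; exists C => f g /closure_ltP cf /closure_ltP cg.
apply/ler_addgt0Pr => e e0; pose e' := e / (2 * C + 2).
have C2 : 0 < 2 * C + 2 by rewrite ltr_wpDl// mulr_ge0.
have e'0 : 0 < e' by rewrite divr_gt0.
have [f' Ff' ff'] := cf _ e'0; have [g' Fg' gg'] := cg _ e'0.
have eE : e = (2 * C + 2) * e' by rewrite mulrC divfK// gt_eqF.
have tri (u v u' v' : L) : `|u - v| <= `|u' - v'| + (`|u - u'| + `|v - v'|).
  have e1 : u - u' - (v - v') = (u - v) - (u' - v') by rewrite !opprD addrACA.
  rewrite -{1}(subrK (u' - v') (u - v)) addrC (le_trans (ler_normD _ _))//.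
  by rewrite lerD2l -e1 ler_normB.
have h1 : `|f - g| <= `|f' - g'| + 2 * e'.
  by rewrite (le_trans (tri f g f' g'))// lerD2l mulr_natl mulr2n lerD// ltW.
have h2 : `|f + g| <= `|f' + g'| + 2 * e'.
  rewrite -(opprK g) -(opprK g') (le_trans (tri f (- g) f' (- g')))//.
  by rewrite lerD2l mulr_natl mulr2n -opprD normrN lerD// ltW.
have h3 : `|Labs f' - Labs g'| <= `|Labs f - Labs g| + 2 * e'.
  rewrite (le_trans (tri _ _ (Labs f) (Labs g)))// lerD2l mulr_natl mulr2n.
  by rewrite lerD// (le_trans (Labs_lipschitz _ _))// distrC ltW.
have h4 : Num.min `|f - g| `|f + g| <= Num.min `|f' - g'| `|f' + g'| + 2 * e'.
  by case: (leP `|f' - g'| `|f' + g'|) => _; rewrite ge_min ?h1 ?h2 ?orbT.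
have h5 := FC _ _ Ff' Fg'.
have h6 := ler_wpM2l C0 h3.
rewrite (le_trans h4)// eE; move: h5 h6; rewrite mulrDr; lra.
Qed.

End Lspace_facts.

(** * The span of the spiky Rademacher functions *)

Section spiky_subspace.
Context {R : realType}.
Local Notation mu := (@lebesgue01 R).

Lemma norm_step (r : R) (r1 : (1 <= r%:E)%E) (f : Lp01 r1) N (G : nat -> R) :
  Lrepr f = step N G %[ae mu] -> `|f| = pnorm r N G.
Proof.
move=> fG; apply: EFin_inj; rewrite (Lspace_norm_ae _ fG).
  rewrite Lnorm_step//; rewrite -lte_fin (lt_le_trans _ r1)// lte_fin//.
exact: measurable_step.
Qed.

Lemma step_Lfun (r : R) (r1 : (1 <= r%:E)%E) N (G : nat -> R) :
  step N G \in Lfun mu r%:E.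
Proof.
have r0 : 0 < r by rewrite -lte_fin (lt_le_trans _ r1)// lte_fin.
by apply: Lfun_intro; [exact: measurable_step|rewrite /finite_norm Lnorm_step// ltry].
Qed.

(** Phase retrieval for [x] and [y] is thereby an overlap estimate for the pair
    [x - y], [x + y]. *)
Lemma dist_normE (x y : R) : Num.min `|x - y| `|x + y| = `| `|x| - `|y| |.
Proof.
apply/le_anti/andP; split; last first.
  by rewrite le_min ler_dist_dist -{2}(opprK y) -(normrN y) ler_dist_dist.
rewrite ge_min; case: (ger0P x) => _; case: (ger0P y) => _.
- by rewrite lexx.
- by rewrite opprK lexx orbT.
- by rewrite -opprD normrN lexx orbT.
- by rewrite -opprD normrN lexx.
Qed.

Section combinations.
Context (r : R) (r1 : (1 <= r%:E)%E) (f g : Lp01 r1) (N : nat) (F G : nat -> R).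
Hypothesis fF : Lrepr f = step N F %[ae mu].
Hypothesis gG : Lrepr g = step N G %[ae mu].

Lemma step_lin (c : R) :
  Lrepr (c *: f + g) = step N (fun k => c * F k + G k) %[ae mu].
Proof.
move: (LreprD (c *: f) g) (LreprZ c f) fF gG.
apply: filterS4 => x /(_ I) E1 /(_ I) E2 /(_ I) E3 /(_ I) E4 _.
rewrite E1 E2 E3 E4.
by rewrite (@comp_step2 _ (fun y z => c * y + z))// mulr0 addr0.
Qed.

Lemma step_dist_abs :
  Lrepr (Labs f - Labs g) = step N (fun k => `|F k| - `|G k|) %[ae mu].
Proof.
move: (LreprB_abs f g) fF gG.
apply: filterS3 => x /(_ I) E1 /(_ I) E3 /(_ I) E4 _; rewrite E1 E3 E4.
by rewrite (@comp_step2 _ (fun y z => `|y| - `|z|))// subrr.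
Qed.

End combinations.

(** The coefficients are full sequences vanishing from [N] on, rather than finite
    families, so that two elements can be written with a common [N]. *)
Definition spiky_span (p : R) (p1 : (1 <= p%:E)%E) : set (Lp01 p1) :=
  [set f : Lp01 p1 | exists a N, (forall n, (N <= n)%N -> a n = 0) /\
     Lrepr f = step N.+1 (spiky_sum (spike_height p) a N) %[ae mu]].

Lemma step_spiky_widen (h a : nat -> R) N M :
  (forall n, (N <= n)%N -> a n = 0) -> (N <= M)%N ->
  step M.+1 (spiky_sum h a M) = step N.+1 (spiky_sum h a N).
Proof.
move=> a0 NM; rewrite -(subnKC NM); elim: (M - N)%N => [|d IH].
  by rewrite addn0.
rewrite addnS -IH; apply/funext => x; rewrite -(step_refine (N + d).+1).
congr (step _ _ x); apply/funext => k /=.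
by rewrite a0 ?leq_addr// mul0r addr0.
Qed.

Lemma spiky_span_common (p : R) (p1 : (1 <= p%:E)%E) (f g : Lp01 p1) :
  spiky_span f -> spiky_span g -> exists N a b,
  [/\ forall n, (N <= n)%N -> a n = 0 /\ b n = 0,
      Lrepr f = step N.+1 (spiky_sum (spike_height p) a N) %[ae mu] &
      Lrepr g = step N.+1 (spiky_sum (spike_height p) b N) %[ae mu]].
Proof.
move=> [a [N [a0 fa]]] [b [M [b0 gb]]]; exists (maxn N M), a, b; split.
- by move=> n; rewrite geq_max => /andP[/a0 -> /b0 ->].
- by rewrite (step_spiky_widen _ a0)// leq_maxl.
- by rewrite (step_spiky_widen _ b0)// leq_maxr.
Qed.

Lemma spiky_span0 (p : R) (p1 : (1 <= p%:E)%E) : spiky_span (0 : Lp01 p1).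
Proof.
exists (fun=> 0), 0%N; split => //.
move: (Lrepr0 mu p1); apply: filterS => x /(_ I) E _.
by rewrite E /step big1// => k _; rewrite mul0r.
Qed.

Lemma spiky_span_lin (p : R) (p1 : (1 <= p%:E)%E) c (f g : Lp01 p1) :
  spiky_span f -> spiky_span g -> spiky_span (c *: f + g).
Proof.
move=> /spiky_span_common/[apply] -[N [a [b [ab0 fa gb]]]].
exists (fun n => c * a n + b n), N; split.
  by move=> n /ab0[-> ->]; rewrite mulr0 addr0.
rewrite (funext (spiky_sum_lin _ _ _ _ N)).
exact: step_lin.
Qed.

Lemma spiky_span_stable (p : R) (p2 : 2 <= p) (p1 : (1 <= p%:E)%E) :
  exists2 C, 0 <= C & forall f g : Lp01 p1, spiky_span f -> spiky_span g ->
    Num.min `|f - g| `|f + g| <= C * `|Labs f - Labs g|.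
Proof.
have [C C0 CP] := overlap_stable p2; exists C => // f g.
move=> /spiky_span_common/[apply] -[N [a [b [_ fa gb]]]].
have fgB : Lrepr (f - g) = step N.+1
    (spiky_sum (spike_height p) (fun n => -1 * b n + a n) N) %[ae mu].
  rewrite addrC -scaleN1r; rewrite (funext (spiky_sum_lin _ _ _ _ N)).
  exact: step_lin.
have fgD : Lrepr (f + g) = step N.+1
    (spiky_sum (spike_height p) (fun n => 1 * a n + b n) N) %[ae mu].
  rewrite -[f]scale1r; rewrite (funext (spiky_sum_lin _ _ _ _ N)).
  exact: step_lin.
rewrite (norm_step fgB) (norm_step fgD) (norm_step (step_dist_abs fa gb)).
apply: le_trans (CP (fun n => -1 * b n + a n) (fun n => 1 * a n + b n) N) _.
apply: (ler_wpM2l C0).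
apply: ler_pnorm => [|k]; first by apply: le_trans p2.
rewrite !spiky_sum_lin mulN1r mul1r addrC dist_normE.
by rewrite normr_id.
Qed.

Lemma incl_step (p q : R) (p1 : (1 <= p%:E)%E) (q1 : (1 <= q%:E)%E)
    (qp : (q%:E <= p%:E)%E) (f : Lp01 p1) N (G : nat -> R) :
  Lrepr f = step N G %[ae mu] -> Lrepr (Lincl q1 qp f) = step N G %[ae mu].
Proof.
move: (Lrepr_incl q1 qp f); apply: filterS2 => x /(_ I) E1 /(_ I) E2 _.
by rewrite E1 E2.
Qed.

(** For [F] and [G] the images of [f_n] and [f_(n+1)], the inequality would give
    [1 / 4 <= |C|^q * 2 rho^n] for all [n], where [rho = 2^(q/p - 1) < 1]. *)
Lemma spiky_span_unstable (p q : R) (p2 : 2 <= p) (p1 : (1 <= p%:E)%E)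
    (q1 : (1 <= q%:E)%E) (qp : q < p) (qp' : (q%:E <= p%:E)%E)
    (E : set (Lp01 p1)) :
  @spiky_span p p1 `<=` E ->
  ~ stable_phase_retrieval (Lincl q1 qp' @` E).
Proof.
move=> spE [C CP]; have q1' : 1 <= q by rewrite -lee_fin.
have q0 : 0 < q by rewrite (lt_le_trans _ q1').
have p0 : 0 < p by rewrite (lt_trans q0).
pose u n N : nat -> R := spiky_sum (spike_height p) (unit_coef n) N.
pose rho : R := 2 `^ (q / p - 1).
have rho0 : 0 < rho by rewrite powR_gt0.
have rho1 : rho < 1.
  rewrite /rho /powR pnatr_eq0 /= expR_lt1 pmulr_llt0 ?ln_gt0 ?ltr1n//.
  by rewrite subr_lt0 ltr_pdivrMr// mul1r.
have uE m n : (m <= n.+1)%N -> exists f : Lp01 p1,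
    E f /\ Lrepr (Lincl q1 qp' f) = step n.+3 (u m n.+2) %[ae mu].
  move=> mn; have fE := LclassE p1 (step_Lfun p1 n.+3 (u m n.+2)).
  exists (Lclass p1 (step_Lfun p1 n.+3 (u m n.+2))); split; last exact: incl_step fE.
  apply: spE; exists (unit_coef m), n.+2; split => // i ni.
  by rewrite /unit_coef gtn_eqF// (leq_trans _ ni).
have key n : 1 / 4 <= `|C| `^ q * (2 * rho ^+ n).
  have [f [Ef fu]] := uE n n (leqnSn n).
  have [g [Eg gu]] := uE n.+1 n (leqnn _).
  have := CP _ _ (imageP _ Ef) (imageP _ Eg).
  move: (Lincl q1 qp' f) (Lincl q1 qp' g) fu gu => {f g Ef Eg} f g fu gu.
  have low (e : R) : `|e| = 1 -> (1 / 4) `^ q^-1 <= `|e *: g + f|.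
    move=> e1; rewrite (norm_step (step_lin gu fu e)) /pnorm.
    rewrite ge0_ler_powR ?nnegrE ?invr_ge0 ?(ltW q0) ?divr_ge0//.
      by apply: avg_ge0 => k; exact: powR_ge0.
    apply: le_trans (separation p n q1' e1) _; apply: ler_avg => k.
    by rewrite addrC.
  have lowmin : (1 / 4) `^ q^-1 <= Num.min `|f - g| `|f + g|.
    rewrite le_min [f - g]addrC [f + g]addrC -scaleN1r -{2}[g]scale1r.
    by rewrite !low ?normrN ?normr1.
  rewrite (norm_step (step_dist_abs fu gu)) => up.
  have {up} := le_trans lowmin (le_trans up (ler_wpM2r (pnorm_ge0 _ _ _) (ler_norm C))).
  rewrite /pnorm overlap_decay// -/rho.
  have r0 m : 0 <= rho ^+ m by rewrite exprn_ge0// ltW.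
  have inv (x : R) : 0 <= x -> (x `^ q^-1) `^ q = x.
    by move=> x0; rewrite -powRrM mulVf ?gt_eqF// powRr1.
  move=> /(ge0_ler_powR (ltW q0)); rewrite !nnegrE powR_ge0 mulr_ge0 ?powR_ge0//.
  move=> /(_ isT isT); rewrite (powRM _ (normr_ge0 C) (powR_ge0 _ _)) !inv ?addr_ge0 ?divr_ge0//.
  move=> /le_trans; apply; rewrite ler_wpM2l ?powR_ge0// mulr_natl mulr2n.
  by rewrite lerD// ler_wiXn2l ?(ltW rho0) ?(ltW rho1)// ?leqW.
pose K := `|C| `^ q; have K0 : 0 <= K := powR_ge0 _ _.
have e0 : 0 < (16 * (K + 1))^-1 by rewrite invr_gt0 mulr_gt0// ltr_wpDl.
have rr : `|rho| < 1 by rewrite ger0_norm// ltW.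
have [n _ /(_ n (leqnn n)) /=] := cvgr0_norm_lt _ (cvg_expr rr) _ e0.
rewrite ger0_norm ?exprn_ge0 ?(ltW rho0)// => rn.
have := key n; rewrite -/K; apply/negP; rewrite -ltNge.
have : K * rho ^+ n <= K * (16 * (K + 1))^-1 by rewrite ler_wpM2l// ltW.
have : K * (16 * (K + 1))^-1 <= 1 / 16.
  rewrite ler_pdivrMr; lra.
lra.
Qed.

End spiky_subspace.

Theorem theorem5p3 (R : realType) (p : R) (p2 : 2 <= p) :
  exists E : set (Lp01 (ge2_ge1 p2)),
    [/\ submod_closed [in E],
        closed E,
        stable_phase_retrieval E
      & forall (q : R) (q1 : (1 <= q%:E)%E) (qp : q < p),
          ~ stable_phase_retrieval (Lincl q1 (lt_leE qp) @` E)].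
Proof.
exists (closure (@spiky_span R p (ge2_ge1 p2))); split.
- apply: closure_submod; first exact: spiky_span0.
  by move=> c f g; exact: spiky_span_lin.
- exact: closed_closure.
- have [C C0 CP] := spiky_span_stable p2 (ge2_ge1 p2).
  exact: closure_stable_phase_retrieval C0 CP.
- move=> q q1 qp; apply: spiky_span_unstable => //; exact: subset_closure.
Qed.
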